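(* Let $G$ be a cubic graph. If $G$ has a $1$-factor, then $\zeta_4(G)=1$. Otherwise, $\zeta_4(G)=2$.
   Context: Graphs are finite and loopless, but may have multiple edges; they need not be connected. A cubic graph is a $3$-regular graph. A $1$-factor is a spanning $1$-regular subgraph (perfect matching). For a non-trivial abelian group $\mathbb{A}$ (written additively, identity $0$), a graph $G$ is zero-sum $\mathbb{A}$-magic if there is a function $\phi: E(G)\to \mathbb{A}\setminus\{0\}$ such that for every vertex $v$ the sum of $\phi(e)$ over all edges $e$ incident to $v$ is $0$. $\mathbb{Z}_n$ is the group of integers modulo $n$, and $\mathbb{Z}_n^k$ is the direct product of $k$ copies of it. For $j\ge 1$, $\zeta_{2j}(G)$ is the smallest positive integer $c$ such that $G$ is zero-sum $\mathbb{Z}_{2j}^c$-magic if such $c$ exists, and $\infty$ otherwise. In particular $\zeta_4(G)$ refers to the groups $\mathbb{Z}_4^c$. *)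

(* Defs.v *)
From HB Require Import structures.
From mathcomp Require Import all_boot all_order all_algebra.
From mathcomp Require Import boolp.
Set Implicit Arguments.
Unset Strict Implicit.
Unset Printing Implicit Defensive.
Import GRing.Theory.
Local Open Scope ring_scope.

(* Distinct edges may have the same ends (multiple edges); since every edge
   has exactly two ends, there are no loops. *)
Record multigraph := Multigraph {
  vertex : finType;
  edge : finType;
  ends : edge -> {set vertex};
  card_ends : forall e, #|ends e| = 2%N
}.

Definition incident (G : multigraph) (v : vertex G) : {set edge G} :=
  [set e | v \in ends e].

Definition regular (k : nat) (G : multigraph) : Prop :=
  forall v : vertex G, #|incident v| = k.

Definition cubic (G : multigraph) : Prop := regular 3 G.

Definition spanning_subgraph (G : multigraph) (M : {set edge G}) : multigraph :=
  @Multigraph (vertex G) {e : edge G | e \in M}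
    (fun e => ends (val e)) (fun e => card_ends (val e)).

Definition has_one_factor (G : multigraph) : Prop :=
  exists M : {set edge G}, regular 1 (spanning_subgraph M).

Definition zero_sum_magic (A : zmodType) (G : multigraph) : Prop :=
  exists phi : edge G -> A,
    (forall e, phi e != 0) /\
    (forall v : vertex G, \sum_(e in incident v) phi e = 0).

(* Meaningful for 2 <= n only: 'Z_0 and 'Z_1 are both the integers mod 2. *)
Definition Zn_power (n k : nat) : zmodType := {ffun 'I_k -> 'Z_n}.

Definition zeta_cond (n : nat) (G : multigraph) : pred nat :=
  fun c => (0 < c)%N && `[< zero_sum_magic (Zn_power n c) G >].

(* The whole subscript of zeta is the argument n (so zeta_{2j} is zeta (2 * j));
   None stands for infinity. *)
Definition zeta (n : nat) (G : multigraph) : option nat :=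
  if pselect (exists c, zeta_cond n G c) is left ex_c
  then Some (ex_minn ex_c) else None.

(* Main.v *)
(** A zero-sum labelling of a cubic graph in [Z/4] with nonzero labels has
    exactly one edge labelled [2] at each vertex; conversely, labelling a
    1-factor by [2] and the other edges by [1] works.

    In [(Z/4)^2] every cubic graph has a labelling. Replacing each edge by its
    two orientations gives a 3-regular bipartite graph (tails against heads),
    which by Hall's theorem has an edge colouring with three colours. Give the
    colours the labels [(1,0)], [(0,1)], [(1,1)] and label each edge by the sum
    over its two orientations: the sum at a vertex is then twice the sum of the
    three labels, which is [(4,4) = 0]. *)
Require Import Defs.
From mathcomp Require Import all_boot.
From mathcomp Require Import all_algebra boolp.
Import GRing.Theory.
Local Open Scope ring_scope.
Set Implicit Arguments.
Unset Strict Implicit.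

(** * Hall's marriage theorem *)

Definition hall_condition (X Y : finType) (N : X -> {set Y}) : Prop :=
  forall S : {set X}, (#|S| <= #|\bigcup_(x in S) N x|)%N.

Definition delete_at (X Y : finType) (N : X -> {set Y}) (x : X) (y : Y) (z : X) :
  {set Y} := if z == x then N z :\ y else N z.

Lemma delete_at_id (X Y : finType) (N : X -> {set Y}) (x : X) (y : Y) (S : {set X}) :
  x \notin S -> \bigcup_(z in S) delete_at N x y z = \bigcup_(z in S) N z.
Proof.
move=> xS; apply: eq_bigr => z zS; rewrite /delete_at.
by case: eqP => // zx; rewrite zx (negPf xS) in zS.
Qed.

(** A set violating the condition after deletion must contain [x], since otherwise its neighbourhood
    is unchanged. Taking [x] out of it gives [S] and turns the strict inequality into a weak one. *)
Lemma hall_delete_violation (X Y : finType) (N : X -> {set Y}) (x : X) (y : Y) :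
  hall_condition N -> ~ hall_condition (delete_at N x y) ->
  exists2 S : {set X}, x \notin S &
    (#|(\bigcup_(z in S) N z) :|: (N x :\ y)| <= #|S|)%N.
Proof.
move=> hallN /existsNP[S /negP]; rewrite -ltnNge => ltS.
have xS : x \in S.
  apply/negPn/negP => xS; move: ltS.
  by rewrite delete_at_id // ltnNge hallN.
exists (S :\ x); first by rewrite !inE eqxx.
move: ltS; rewrite (big_setD1 x) //= delete_at_id ?inE ?eqxx // /delete_at eqxx.
by rewrite (cardsD1 x S) xS add1n ltnS setUC.
Qed.

(* Rado: violators [S1], [S2] for the deletions of [y1], [y2] would contradict
   the Hall condition for [x |: S1 :|: S2] and [S1 :&: S2], by submodularity. *)
Lemma hall_delete (X Y : finType) (N : X -> {set Y}) (x : X) (y1 y2 : Y) :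
  hall_condition N -> y1 != y2 ->
  hall_condition (delete_at N x y1) \/ hall_condition (delete_at N x y2).
Proof.
move=> hallN y12.
have [|/(hall_delete_violation hallN)[S1 xS1 le1]] :=
  pselect (hall_condition (delete_at N x y1)); first by left.
have [|/(hall_delete_violation hallN)[S2 xS2 le2]] :=
  pselect (hall_condition (delete_at N x y2)); first by right.
exfalso; move: le1 le2.
set P := _ :|: _; set Q := _ :|: (_ :\ y2) => le1 le2.
have leU : (#|S1 :|: S2|.+1 <= #|P :|: Q|)%N.
  have -> : #|S1 :|: S2|.+1 = #|x |: (S1 :|: S2)|.
    by rewrite cardsU1 inE negb_or xS1 xS2.
  apply: leq_trans (hallN _) (subset_leq_card _).
  apply/bigcupsP => z; rewrite !inE => zS; apply/subsetP => w wz.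
  rewrite !inE; case/or3P: zS => [/eqP zx|zS|zS].
  (* As [y1 != y2], the sets [N x :\ y1] and [N x :\ y2] together cover [N x]. *)
  - rewrite -zx wz; have [->|] := eqVneq w y1; last by rewrite orbT.
    by rewrite y12 !orbT.
  - by apply/orP; left; apply/orP; left; apply/bigcupP; exists z.
  - by apply/orP; right; apply/orP; left; apply/bigcupP; exists z.
have leI : (#|S1 :&: S2| <= #|P :&: Q|)%N.
  apply: leq_trans (hallN _) (subset_leq_card _).
  apply/bigcupsP => z /setIP[z1 z2]; apply/subsetP => w wz.
  by rewrite !inE; apply/andP; split; apply/orP; left; apply/bigcupP; exists z.
have := leq_add leU leI.
by rewrite addSn !cardsUI ltnNge leq_add.
Qed.

(** Induction on the total size of the sets [N x]. By [hall_delete], a set with two elements can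
    lose one of them; once no set has two, the Hall condition for one and two points makes them
    distinct singletons. *)
Theorem hall (X Y : finType) (N : X -> {set Y}) :
  hall_condition N -> exists2 f : X -> Y, injective f & forall x, f x \in N x.
Proof.
have [n] := ubnP (\sum_x #|N x|)%N; elim: n => // n IHn in N *.
move=> leN hallN.
have [[x /card_gt1P[y1 [y2 [y1x y2x y12]]]]|small] :=
    pselect (exists x, (1 < #|N x|)%N).
  have step y : y \in N x -> hall_condition (delete_at N x y) ->
      exists2 f : X -> Y, injective f & forall x, f x \in N x.
    move=> yx hallD; have [] := IHn (delete_at N x y) _ hallD.
      rewrite -ltnS; apply: leq_trans leN; rewrite ltnS (bigD1 x) //= [in leqRHS](bigD1 x) //=.
      rewrite /delete_at eqxx [in ltnRHS](cardsD1 y) yx add1n addSn ltnS leq_add2l.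
      by apply: leq_sum => z /negPf->.
    move=> f injf fN; exists f => // z; have := fN z.
    by rewrite /delete_at; case: ifP => // _ /setD1P[].
  by case: (hall_delete x hallN y12); apply: step.
have card1 x : exists y, N x == [set y].
  suff /cards1P[y ->] : #|N x| == 1%N by exists y.
  rewrite eqn_leq; apply/andP; split.
    by rewrite leqNgt; apply/negP => ?; apply: small; exists x.
  by have := hallN [set x]; rewrite big_set1 cards1.
exists (fun x => xchoose (card1 x)) => [x z|x].
  have /eqP Nx := xchooseP (card1 x); have /eqP Nz := xchooseP (card1 z).
  move: (xchoose _) (xchoose _) Nx Nz => a b Nx Nz ab.
  apply/eqP/negPn/negP => xz.
  have := hallN [set x; z].
  by rewrite bigcup_setU !big_set1 Nx Nz ab setUid cards1 cards2 xz.
by have /eqP Nx := xchooseP (card1 x); rewrite {2}Nx set11.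
Qed.

(** * Edge colouring of regular bipartite multigraphs *)

Definition fiber (T X : finType) (A : {set T}) (f : T -> X) (x : X) : {set T} :=
  [set a in A | f a == x].

Lemma card_preim_fiber (T X : finType) (A : {set T}) (f : T -> X) (r : nat)
    (S : {set X}) :
  (forall x, #|fiber A f x| = r) -> #|[set a in A | f a \in S]| = (#|S| * r)%N.
Proof.
move=> fibr; rewrite -sum1_card (partition_big f (mem S)) /=; last first.
  by move=> a; rewrite inE => /andP[].
rewrite -sum_nat_const; apply: eq_bigr => x xS.
rewrite -(fibr x) -sum1_card; apply: eq_bigl => a.
by rewrite !inE; case: eqP => [->|]; rewrite ?xS ?andbT ?andbF.
Qed.

(** [A] is the edge set of a bipartite multigraph with a copy of [X] on each side. The [#|S| * r.+1]
    edges out of [S] are among the edges into its neighbourhood, which gives the Hall condition. *)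
Lemma regular_bipartite_matching (T X : finType) (A : {set T}) (src tgt : T -> X)
    (r : nat) :
  (forall x, #|fiber A src x| = r.+1) -> (forall x, #|fiber A tgt x| = r.+1) ->
  exists2 M : {set T}, M \subset A &
    (forall x, #|fiber M src x| = 1%N) /\ (forall x, #|fiber M tgt x| = 1%N).
Proof.
move=> srcr tgtr; pose N x := tgt @: fiber A src x.
have [S|f injf fN] := @hall X X N.
  rewrite -(leq_pmul2r (ltn0Sn r)) -(card_preim_fiber _ srcr).
  rewrite -(card_preim_fiber _ tgtr); apply/subset_leq_card/subsetP => a.
  rewrite !inE => /andP[aA aS]; rewrite aA; apply/bigcupP; exists (src a) => //.
  by apply: imset_f; rewrite inE aA eqxx.
have exm x : exists a, [&& a \in A, src a == x & tgt a == f x].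
  by have /imsetP[a] := fN x; rewrite inE => /andP[aA sa] ->; exists a; rewrite aA sa /=.
pose m x := xchoose (exm x).
have mP x : [/\ m x \in A, src (m x) = x & tgt (m x) = f x].
  by have /and3P[? /eqP ? /eqP ?] := xchooseP (exm x).
exists (m @: setT).
  by apply/subsetP => _ /imsetP[x _ ->]; have [] := mP x.
split=> x; apply/eqP/cards1P.
  exists (m x); apply/setP => a; rewrite !inE; apply/andP/eqP => [[]|->].
    by case/imsetP => y _ -> /eqP; have [_ -> _] := mP y => ->.
  by rewrite imset_f ?inE //; have [_ -> _] := mP x.
(* An injective self-map of the finite type [X] is onto, so the matching also covers every
   target. *)
have [g _ fK] := injF_bij injf.
exists (m (g x)); apply/setP => a; rewrite !inE; apply/andP/eqP => [[]|->].
  case/imsetP => y _ -> /eqP; have [_ _ ->] := mP y => fy.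
  by congr m; apply: injf; rewrite fK.
by rewrite imset_f ?inE //; have [_ _ ->] := mP (g x); rewrite fK.
Qed.

(** Induction on [r]: a perfect matching is removed and becomes the last colour class. *)
Lemma regular_bipartite_coloring (T X : finType) (A : {set T}) (src tgt : T -> X)
    (r : nat) :
  (forall x, #|fiber A src x| = r) -> (forall x, #|fiber A tgt x| = r) ->
  exists c : T -> nat,
    [/\ {in A, forall a, (c a < r)%N},
        {in A &, forall a b, src a = src b -> c a = c b -> a = b} &
        {in A &, forall a b, tgt a = tgt b -> c a = c b -> a = b}].
Proof.
elim: r => [|r IHr] in A *.
  move=> srcr _.
  have A0 a : a \in A -> False.
    move=> aA; have /eqP := srcr (src a).
    by rewrite cards_eq0 => /eqP/setP/(_ a); rewrite !inE aA eqxx.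
  by exists (fun=> 0%N); split=> [a /A0 //|a b /A0 //|a b /A0 //].
move=> srcr tgtr.
have [M MA [srcM tgtM]] := regular_bipartite_matching srcr tgtr.
have fibD (f : T -> X) x : (forall x, #|fiber A f x| = r.+1) ->
    (forall x, #|fiber M f x| = 1%N) -> #|fiber (A :\: M) f x| = r.
  move=> fA fM; have -> : fiber (A :\: M) f x = fiber A f x :\: fiber M f x.
    by apply/setP => a; rewrite !inE; case: (a \in M); case: (f a == x); rewrite ?andbF ?andbT.
  rewrite cardsD (setIidPr _) ?fA ?fM ?subSS ?subn0 //.
  by apply/subsetP => a; rewrite !inE => /andP[/(subsetP MA)-> ->].
have [c [cr csrc ctgt]] := IHr _ (fun x => fibD _ x srcr srcM) (fun x => fibD _ x tgtr tgtM).
pose c' a := if a \in M then r else c a.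
have c'r a : a \in A -> (c' a < r.+1)%N.
  by move=> aA; rewrite /c'; case: ifP => // aM; rewrite ltnW // ltnS cr // !inE aM.
have inj (f : T -> X) : (forall x, #|fiber M f x| = 1%N) ->
    {in A :\: M &, forall a b, f a = f b -> c a = c b -> a = b} ->
    {in A &, forall a b, f a = f b -> c' a = c' b -> a = b}.
  move=> fM cf a b aA bA fab; rewrite /c'.
  case: ifPn => aM; case: ifPn => bM.
  - have /eqP/cards1P[m /setP mE] := fM (f a).
    move: (mE a) (mE b); rewrite !inE aM bM fab eqxx.
    by move=> /esym/eqP -> /esym/eqP ->.
  - by move=> rc; have := cr b; rewrite -rc ltnn inE bM bA => /(_ isT).
  - by move=> cr'; have := cr a; rewrite cr' ltnn inE aM aA => /(_ isT).
  - by apply: cf; rewrite // inE ?aM ?bM.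
by exists c'; split; [exact: c'r|exact: inj|exact: inj].
Qed.

(** By counting, [k] takes each value below [r] exactly once on [B], so the two sums differ by a
    reindexing. *)
Lemma sum_bijective_labels (I : finType) (V : zmodType) (B : {set I}) (k : I -> nat)
    (r : nat) (g : nat -> V) :
  #|B| = r -> {in B, forall i, (k i < r)%N} -> {in B &, injective k} ->
  \sum_(i in B) g (k i) = \sum_(0 <= j < r) g j.
Proof.
move=> cardB kr injk.
rewrite -[LHS]big_enum /= -(big_map k xpredT g); apply: perm_big.
have ukB : uniq (map k (enum B)).
  by rewrite map_inj_in_uniq ?enum_uniq // => i j; rewrite !mem_enum; apply: injk.
have sub : {subset map k (enum B) <= index_iota 0 r}.
  by move=> _ /mapP[i + ->]; rewrite mem_enum mem_index_iota => /kr.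
have [|_ eqm] := uniq_min_size ukB sub.
  by rewrite size_iota size_map -cardE cardB subn0.
by apply: uniq_perm; rewrite ?iota_uniq.
Qed.

(** * Oriented edges and the labelling they induce *)

(** The pair [(e, v)] stands for the edge [e] oriented with tail [v]; its head is [opposite e v]. *)
Definition arcs (G : multigraph) : {set edge G * vertex G} :=
  [set a | a.2 \in ends a.1].

(** The default [v] is never reached, because [ends e] has two elements. *)
Definition opposite (G : multigraph) (e : edge G) (v : vertex G) : vertex G :=
  odflt v [pick w in ends e :\ v].

Lemma ends_opposite (G : multigraph) (e : edge G) (v : vertex G) :
  v \in ends e -> ends e :\ v = [set opposite e v].
Proof.
move=> ve; have /cards1P[w def_w] : #|ends e :\ v| == 1%N.
  by have := card_ends e; rewrite (cardsD1 v) ve add1n => -[->].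
rewrite /opposite def_w; case: pickP => [u|/(_ w)]; last by rewrite set11.
by rewrite inE => /eqP->.
Qed.

Lemma opposite_in (G : multigraph) (e : edge G) (v : vertex G) :
  v \in ends e -> opposite e v \in ends e.
Proof.
move/ends_opposite => E; have := set11 (opposite e v).
by rewrite -E => /setD1P[].
Qed.

Lemma opposite_neq (G : multigraph) (e : edge G) (v : vertex G) :
  v \in ends e -> opposite e v != v.
Proof.
move/ends_opposite => E; have := set11 (opposite e v).
by rewrite -E => /setD1P[].
Qed.

Lemma oppositeK (G : multigraph) (e : edge G) (v : vertex G) :
  v \in ends e -> opposite e (opposite e v) = v.
Proof.
move=> ve; have /setP/(_ v) := ends_opposite (opposite_in ve).
by rewrite !inE ve eq_sym opposite_neq // => /esym/eqP.
Qed.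

Lemma card_arcs_from (G : multigraph) (v : vertex G) :
  #|fiber (arcs G) snd v| = #|incident v|.
Proof.
rewrite -(card_imset (incident v) (f := fun e => (e, v))) => [|e e' []//].
apply: eq_card => -[e w]; rewrite !inE /=; apply/andP/imsetP => [[we /eqP wv]|[e']].
  by exists e; rewrite ?inE -?wv.
by rewrite inE => ve [-> ->].
Qed.

Lemma card_arcs_to (G : multigraph) (v : vertex G) :
  #|fiber (arcs G) (fun a => opposite a.1 a.2) v| = #|incident v|.
Proof.
rewrite -(card_imset (incident v) (f := fun e => (e, opposite e v))) => [|e e' []//].
apply: eq_card => -[e w]; rewrite !inE /=; apply/andP/imsetP => [[we /eqP wv]|[e']].
  by exists e; rewrite ?inE -?wv ?opposite_in // oppositeK.
by rewrite inE => ve [-> ->]; rewrite opposite_in // oppositeK.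
Qed.

(** The two arcs of an edge may share a colour, so the condition on [g i + g j] includes [i = j]. At
    each vertex the outgoing arcs carry every colour once, and so do the incoming ones, whence the
    factor 2. *)
Lemma regular_magic (G : multigraph) (r : nat) (V : zmodType) (g : nat -> V) :
  regular r G -> (forall i j, (i < r)%N -> (j < r)%N -> g i + g j != 0) ->
  (\sum_(0 <= i < r) g i) *+ 2 = 0 -> zero_sum_magic V G.
Proof.
move=> regG gN0 sum_g.
have [v|v|c [cr csrc ctgt]] := @regular_bipartite_coloring _ _ (arcs G) snd
    (fun a => opposite a.1 a.2) r; first by rewrite card_arcs_from regG.
  by rewrite card_arcs_to regG.
have arcE e v : ((e, v) \in arcs G) = (v \in ends e) by rewrite inE.
pose phi e := \sum_(v in ends e) g (c (e, v)).
have phiE e v : v \in ends e -> phi e = g (c (e, v)) + g (c (e, opposite e v)).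
  by move=> ve; rewrite /phi (big_setD1 v) //= ends_opposite // big_set1.
exists phi; split=> [e|v].
  have /card_gt0P[v ve] : (0 < #|ends e|)%N by rewrite card_ends.
  by rewrite (phiE _ _ ve) gN0 // cr // arcE // opposite_in.
rewrite (eq_bigr (fun e => g (c (e, v)) + g (c (e, opposite e v)))); last first.
  by move=> e; rewrite inE => /phiE.
(* Of the four side goals, the first two concern the arcs into [v] and the last two the arcs out of
   [v]. *)
rewrite big_split /= !(@sum_bijective_labels _ _ _ _ r) ?regG // => [e|e e'|e|e e'].
- by rewrite inE => ve; rewrite cr // arcE opposite_in.
- rewrite !inE => ve ve' ceq.
  by have := ctgt (e, opposite e v) (e', opposite e' v);
     rewrite !arcE !opposite_in //= !oppositeK // => /(_ isT isT erefl ceq)[].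
- by rewrite inE => ve; rewrite cr // arcE.
- rewrite !inE => ve ve' ceq.
  by have := csrc (e, v) (e', v); rewrite !arcE => /(_ ve ve' erefl ceq)[].
Qed.

(** * Cubic graphs and the powers of ['Z_4] *)

Lemma has_one_factorP (G : multigraph) :
  has_one_factor G <->
  exists M : {set edge G}, forall v : vertex G, #|incident v :&: M| = 1%N.
Proof.
have cardM (M : {set edge G}) (v : vertex G) :
    #|@incident (spanning_subgraph M) v| = #|incident v :&: M|.
  rewrite -(card_imset _ val_inj); apply: eq_card => e; rewrite !inE.
  apply/imsetP/andP => [[f + ->]|[ve eM]]; first by rewrite inE (valP f).
  by exists (Sub e eM); rewrite ?inE.
by split=> -[M oneM]; exists M => v; have := oneM v; rewrite cardM.
Qed.

Lemma cubic_magic_Z4P (G : multigraph) :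
  cubic G -> zero_sum_magic (Zn_power 4 1) G <-> has_one_factor G.
Proof.
move=> cubicG; rewrite has_one_factorP; split=> [[phi [phiN0 sum_phi]]|[M oneM]].
  pose psi e : 'Z_4 := (phi e : {ffun 'I_1 -> 'Z_4}) ord0.
  have psiN0 e : psi e != 0.
    apply: contra (phiN0 e) => /eqP psi0; apply/eqP/ffunP => i.
    by rewrite ord1 ffunE.
  have sum_psi v : \sum_(e in incident v) psi e = 0.
    have /ffunP/(_ ord0) := sum_phi v.
    by rewrite sum_ffunE ffunE.
  (* By parity, an even number of the three values is odd, so one or all three equal 2; three 2s
     would sum to 2. *)
  have oddE (x y z : 'Z_4) : x != 0 -> y != 0 -> z != 0 -> x + (y + z) = 0 ->
      ((x == 2%R) + ((y == 2%R) + (z == 2%R)) = 1)%N.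
    move=> + + + /eqP.
    by case: x => [[|[|[|[|]]]] ?] //; case: y => [[|[|[|[|]]]] ?] //;
       case: z => [[|[|[|[|]]]] ?].
  exists [set e | psi e == 2] => v.
  rewrite -sum1_card (eq_bigl (fun e => (e \in incident v) && (psi e == 2))); last first.
    by move=> e; rewrite !inE.
  rewrite big_mkcondr -big_enum /=.
  have := sum_psi v; rewrite -big_enum /=.
  have := cubicG v; rewrite cardE.
  case: (enum _) => [|a [|b [|d [|]]]] //= _.
  by rewrite !big_cons !big_nil addr0 addn0; apply: oddE.
pose psi e : 'Z_4 := if e \in M then 2 else 1.
exists (fun e => [ffun=> psi e] : {ffun 'I_1 -> 'Z_4}); split=> [e|v].
  by apply/eqP => /ffunP/(_ ord0); rewrite !ffunE /psi; case: ifP.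
apply/ffunP => i; rewrite sum_ffunE ffunE.
rewrite (eq_bigr psi) => [|e _]; last by rewrite ffunE.
rewrite (big_setID M) /= (eq_bigr (fun=> 2)); last first.
  by move=> e /setIP[_ eM]; rewrite /psi eM.
rewrite [X in _ + X](eq_bigr (fun=> 1)); last first.
  by move=> e /setDP[_ eM]; rewrite /psi (negPf eM).
(* One edge labelled 2 and two labelled 1 give 4, which is 0 in ['Z_4]. *)
by rewrite !sumr_const cardsD cubicG oneM; apply/eqP.
Qed.

(* The three nonzero vectors of [(Z/2)^2]: they sum to zero modulo 2, and no
   two of them (equal or not) are opposite modulo 4. *)
Definition label (i : nat) : {ffun 'I_2 -> 'Z_4} :=
  [ffun k => ((i == 2) || (i == val k))%:R].

Lemma cubic_magic_Z4_square (G : multigraph) :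
  cubic G -> zero_sum_magic (Zn_power 4 2) G.
Proof.
move=> cubicG; apply: (@regular_magic _ 3 _ label) => // [i j i3 j3|].
  (* Entries are 0 or 1, so a coordinate of the sum is at most 2 and vanishes only if both entries
     do; but each label has an entry 1. *)
  apply/eqP => /ffunP E; move: (E ord0) (E ord_max); rewrite !ffunE.
  by case: i i3 {E} => [|[|[|]]] // _; case: j j3 => [|[|[|]]].
apply/ffunP => k; rewrite unlock /= !ffunE.
by case: k => [[|[|]]] // ?; apply/eqP.
Qed.

Local Close Scope ring_scope.

Theorem theorem4p3 (G : multigraph) (cubicG : cubic G) :
  (has_one_factor G -> zeta 4 G = Some 1) /\
  (~ has_one_factor G -> zeta 4 G = Some 2).
Proof.
have cond2 : zeta_cond 4 G 2.
  by apply/andP; split=> //; apply/asboolP/cubic_magic_Z4_square.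
rewrite /zeta; case: pselect => [ex_c|[]]; last by exists 2.
case: ex_minnP => m condm min_m; split=> factG; congr Some.
  apply/eqP; rewrite eqn_leq; have /andP[-> _] := condm; rewrite andbT min_m //.
  by apply/andP; split=> //; apply/asboolP/cubic_magic_Z4P.
(* Here [m] is 1 or 2, and [m = 1] would produce a 1-factor. *)
apply/eqP; rewrite eqn_leq min_m //= ltn_neqAle; have /andP[-> /asboolP magm] := condm.
rewrite andbT; apply/eqP => m1; apply/factG/cubic_magic_Z4P => //.
by rewrite -m1 in magm.
Qed.
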